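(* Conditional on observables, if $Y_{d',m'}-Y_{d,m}$ is constant across all individuals, then $NIE^{IV}_d=NIE_d$ and $NDE^{IV}_d=NDE_d$ for all $d=0,1$.
   Context: Setting. For each individual in a random sample, $D\in\{0,1\}$ is a treatment, $M\in\{0,1\}$ an observed mediator, $Y\in\mathbb{R}$ an observed outcome and $Z\in\{0,1\}$ a binary instrument. Covariates are suppressed and everything is implicitly conditional on them. $Y_{d,m}$ (also written $Y_{dm}$) is the potential outcome when the treatment is set to $d$ and the mediator to $m$. $Y_{d,m,z}$ is the potential outcome when in addition the instrument is set to $z$. $M_{d,z}$ (also written $M_{dz}$) is the potential mediator when the treatment is set to $d$ and the instrument to $z$, and $M_d=M_{d,Z}$. $Y_{d,M_{d',z}}$ is the potential outcome when the treatment is set to $d$ and the mediator to the value $M_{d',z}$; similarly for $Y_{d,M_{d'}}=Y_{d,M_{d',Z}}$. The observed variables satisfy $M=M_{D,Z}$ and $Y=Y_{D,M_D}$. Assumptions ($\perp\!\!\!\perp$ denotes mean independence). Treatment exogeneity: for all $d,d',m$, $\{Y_{d,m},M_{d'}\}\perp\!\!\!\perp D$. Binary instrument: for all $d,d',m,z$, (i) randomization: $\{Y_{d,m},M_{d',z},D\}\perp\!\!\!\perp Z$; (ii) exclusion restriction: $Y_{d,m,z}=Y_{d,m}$; (iii) relevance: $\Pr(M|Z=z)$ is a nontrivial function of $z$. IV coefficients. Postulate the (possibly misspecified) linear model $Y=D(\alpha_0+\alpha_1M)+(1-D)(\beta_0+\beta_1M)+u$, $M=D(\pi_0+\pi_1Z)+(1-D)(\tau_0+\tau_1Z)+v$,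 with $\mathbf{E}[u|D,Z]=\mathbf{E}[v|D,Z]=0$. The coefficients $\alpha,\beta$ are estimated by the IV regression of $Y$ on $M$ using $Z$ as instrument, separately for each value of $D$, that is, from the moment conditions $\mathbf{E}[Du]=\mathbf{E}[DZu]=0$ and $\mathbf{E}[(1-D)u]=\mathbf{E}[(1-D)Zu]=0$. The coefficients $\pi,\tau$ are those of the regression of $M$ on $Z$ separately for each value of $D$. The superscript $IV$ denotes the probability limit of the resulting estimator. IV estimands (probability limits of the estimated mediation effects): $NIE_0^{IV}=\beta_1^{IV}\big(\pi_0^{IV}-\tau_0^{IV}+(\pi_1^{IV}-\tau_1^{IV})\mathbf{E}[Z]\big)$, $NIE_1^{IV}=\alpha_1^{IV}\big(\pi_0^{IV}-\tau_0^{IV}+(\pi_1^{IV}-\tau_1^{IV})\mathbf{E}[Z]\big)$, $NDE_0^{IV}=\alpha_0^{IV}-\beta_0^{IV}+(\alpha_1^{IV}-\beta_1^{IV})\big(\tau_0^{IV}+\tau_1^{IV}\mathbf{E}[Z]\big)$, $NDE_1^{IV}=\alpha_0^{IV}-\beta_0^{IV}+(\alpha_1^{IV}-\beta_1^{IV})\big(\pi_0^{IV}+\pi_1^{IV}\mathbf{E}[Z]\big)$. Target parameters (natural indirect and direct effects), for $d\in\{0,1\}$: $NIE_d=\mathbf{E}[Y_{d,M_{1,Z}}-Y_{d,M_{0,Z}}]=\sum_{z\in\{0,1\}}\mathbf{E}[Y_{d,M_{1,z}}-Y_{d,M_{0,z}}]\Pr(Z=z)$, $NDE_d=\mathbf{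E}[Y_{1,M_{d,Z}}-Y_{0,M_{d,Z}}]=\sum_{z\in\{0,1\}}\mathbf{E}[Y_{1,M_{d,z}}-Y_{0,M_{d,z}}]\Pr(Z=z)$.
   Formalization: Mean independence of a collection is taken jointly (products of its members are mean independent too), since the member-by-member reading makes the claim false; the IV limits are taken as the unique solutions of the population moment conditions. *)

(* Defs.v *)
(* The population is a probability space (T, P), an
   individual being a point of T; P is the law given the covariates.  Binary
   variables are bool-valued, with true standing for 1. *)
From HB Require Import structures.
From mathcomp Require Export all_boot all_order all_algebra.
From mathcomp Require Export all_classical all_reals all_analysis.
Export Order.TTheory GRing.Theory Num.Theory.
Export numFieldNormedType.Exports.
Set Implicit Arguments.
Unset Strict Implicit.
Unset Printing Implicit Defensive.

Local Open Scope classical_set_scope.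
Local Open Scope ring_scope.

(* The real value of 'E_P[X]; only ever applied to integrable X, as [fine]
   would send an infinite expectation to 0. *)
Definition mean {dT : measure_display} {T : measurableType dT} {R : realType}
    (P : probability T R) (X : T -> R) : R :=
  fine ('E_P[X])%E.

Definition prob {dT : measure_display} {T : measurableType dT} {R : realType}
    (P : probability T R) (A : set T) : R :=
  fine (P A).

(* E[X | W = w], meaningful when prob P [set t | W t = w] != 0. *)
Definition cond_mean {dT : measure_display} {T : measurableType dT}
    {R : realType} (P : probability T R) (X : T -> R) (W : T -> bool)
    (w : bool) : R :=
  mean P (fun t => X t * (W t == w)%:R) / prob P [set t | W t = w].

Definition cond_prob {dT : measure_display} {T : measurableType dT}
    {R : realType} (P : probability T R) (A B : set T) : R :=
  prob P (A `&` B) / prob P B.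

Definition mean_indep {dT : measure_display} {T : measurableType dT}
    {R : realType} (P : probability T R) (X : T -> R) (W : T -> bool) : Prop :=
  forall w : bool, prob P [set t | W t = w] != 0 ->
    cond_mean P X W w = mean P X.

(* Mean independence of a collection {X_1, ..., X_k} from W is joint: it bears
   on the product of every subcollection (selected by the mask s).  It is used
   with at most one nonbinary X_i, the outcome; it then says that the joint law
   of the binary members, and the mean of the outcome on each event they
   define, do not depend on W.  In particular it makes composites such as
   Y_{d, M_{d'}} mean independent of W; mean independence of each X_i
   separately would not. *)
Definition joint_mean_indep {dT : measure_display} {T : measurableType dT}
    {R : realType} (P : probability T R) (Xs : seq (T -> R)) (W : T -> bool) :
    Prop :=
  forall s : bitseq,
    mean_indep P (fun t => \prod_(X <- mask s Xs) X t) W.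

(* In the next two definitions, Yp d m is Y_{d,m} and Mp d z is M_{d,z}. *)

Definition treatment_exogeneity {dT : measure_display}
    {T : measurableType dT} {R : realType} (P : probability T R)
    (D Z : T -> bool) (Mp : bool -> bool -> T -> bool)
    (Yp : bool -> bool -> T -> R) : Prop :=
  forall d d' m : bool,
    joint_mean_indep P
      [:: Yp d m; (fun t => (Mp d' (Z t) t)%:R)] D.

Definition instrument_randomization {dT : measure_display}
    {T : measurableType dT} {R : realType} (P : probability T R)
    (D Z : T -> bool) (Mp : bool -> bool -> T -> bool)
    (Yp : bool -> bool -> T -> R) : Prop :=
  forall d d' m z : bool,
    joint_mean_indep P
      [:: Yp d m; (fun t => (Mp d' z t)%:R); (fun t => (D t)%:R)] Z.

(* z |-> Pr(M = 1 | Z = z) is well defined and not constant. *)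
Definition instrument_relevance {dT : measure_display}
    {T : measurableType dT} {R : realType} (P : probability T R)
    (M Z : T -> bool) : Prop :=
  (forall z : bool, 0 < prob P [set t | Z t = z]) /\
  cond_prob P [set t | M t = true] [set t | Z t = true] <>
  cond_prob P [set t | M t = true] [set t | Z t = false].

(* Coefficients of V = D (a0 + a1 X) + (1 - D) (b0 + b1 X) + residual. *)
Record coefs (R : realType) := Coefs { a0 : R; a1 : R; b0 : R; b1 : R }.

Definition residual {T : Type} {R : realType} (D X : T -> bool) (V : T -> R)
    (c : coefs R) (t : T) : R :=
  V t - ((D t)%:R * (a0 c + a1 c * (X t)%:R)
         + (1 - (D t)%:R) * (b0 c + b1 c * (X t)%:R)).

Definition moment_conditions {dT : measure_display} {T : measurableType dT}
    {R : realType} (P : probability T R) (D Z X : T -> bool) (V : T -> R)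
    (c : coefs R) : Prop :=
  let u := residual D X V c in
  [/\ mean P (fun t => (D t)%:R * u t) = 0,
      mean P (fun t => (D t)%:R * (Z t)%:R * u t) = 0,
      mean P (fun t => (1 - (D t)%:R) * u t) = 0 &
      mean P (fun t => (1 - (D t)%:R) * (Z t)%:R * u t) = 0].

(* Probability limit of the IV regression of V on X with instrument Z, run
   separately for each value of D: the unique solution of the population moment
   conditions.  Without uniqueness the coefficients are not identified and the
   estimator has no well-defined limit.  X = Z gives least squares on Z. *)
Definition IV_limit {dT : measure_display} {T : measurableType dT}
    {R : realType} (P : probability T R) (D Z X : T -> bool) (V : T -> R)
    (c : coefs R) : Prop :=
  moment_conditions P D Z X V c /\
  forall c' : coefs R, moment_conditions P D Z X V c' -> c' = c.

(* Below, cY holds (alpha_0, alpha_1, beta_0, beta_1), cM holds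
   (pi_0, pi_1, tau_0, tau_1) and EZ is the mean of Z. *)

Definition NIE_IV {R : realType} (cY cM : coefs R) (EZ : R) (d : bool) : R :=
  (if d then a1 cY else b1 cY)
  * (a0 cM - b0 cM + (a1 cM - b1 cM) * EZ).

Definition NDE_IV {R : realType} (cY cM : coefs R) (EZ : R) (d : bool) : R :=
  a0 cY - b0 cY
  + (a1 cY - b1 cY) * (if d then a0 cM + a1 cM * EZ else b0 cM + b1 cM * EZ).

Definition NIE {dT : measure_display} {T : measurableType dT} {R : realType}
    (P : probability T R) (Z : T -> bool) (Mp : bool -> bool -> T -> bool)
    (Yp : bool -> bool -> T -> R) (d : bool) : R :=
  mean P (fun t => Yp d (Mp true (Z t) t) t - Yp d (Mp false (Z t) t) t).

Definition NDE {dT : measure_display} {T : measurableType dT} {R : realType}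
    (P : probability T R) (Z : T -> bool) (Mp : bool -> bool -> T -> bool)
    (Yp : bool -> bool -> T -> R) (d : bool) : R :=
  mean P (fun t => Yp true (Mp d (Z t) t) t - Yp false (Mp d (Z t) t) t).

(* Main.v *)
(* Write Y_{d,m} = Y_{0,0} + k_{d,m} with constants k.  Then
   Y = D (k_{1,0} + (k_{1,1} - k_{1,0}) M) + (1 - D) k_{0,1} M + Y_{0,0}, so the
   linear outcome model holds with residual Y_{0,0} - E[Y_{0,0}], which is
   orthogonal to 1, D, Z and DZ: the IV coefficients are read off this equation.
   The individual M_{d,z} need not be mean independent of D, so pi and tau need
   not be causal.  But the moment condition E[Dv] = 0, combined with the mean
   independence of D from Z and of M_{1,Z} from D, gives
   pi_0 + pi_1 E[Z] = E[M_{1,Z}], and likewise tau_0 + tau_1 E[Z] = E[M_{0,Z}];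
   only these two averages enter the effects.
   Overlap, 0 < Pr(D = 1) < 1, is forced by uniqueness of the coefficients. *)
Require Import Defs.
From mathcomp Require Import measurable_realfun ring.
Set Implicit Arguments.
Unset Strict Implicit.
Unset Printing Implicit Defensive.
Local Open Scope classical_set_scope.
Local Open Scope ring_scope.

Definition L1 {dT : measure_display} {T : measurableType dT} {R : realType}
    (P : probability T R) (f : T -> R) : Prop :=
  P.-integrable [set: T] (EFin \o f).

Lemma L1D {dT : measure_display} {T : measurableType dT} {R : realType}
    (P : probability T R) (f g : T -> R) :
  L1 P f -> L1 P g -> L1 P (fun t => f t + g t).
Proof. by move=> If Ig; exact: (integrableD measurableT If Ig). Qed.

Lemma L1B {dT : measure_display} {T : measurableType dT} {R : realType}
    (P : probability T R) (f g : T -> R) :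
  L1 P f -> L1 P g -> L1 P (fun t => f t - g t).
Proof. by move=> If Ig; exact: (integrableB measurableT If Ig). Qed.

Lemma L1Z {dT : measure_display} {T : measurableType dT} {R : realType}
    (P : probability T R) (k : R) (f : T -> R) :
  L1 P f -> L1 P (fun t => k * f t).
Proof. by move=> If; exact: (integrableZl measurableT k If). Qed.

Lemma L1_cst {dT : measure_display} {T : measurableType dT} {R : realType}
    (P : probability T R) (k : R) : L1 P (fun=> k).
Proof. exact: (finite_measure_integrable_cst P k measurableT). Qed.

Lemma L1M_bool {dT : measure_display} {T : measurableType dT} {R : realType}
    (P : probability T R) (f : T -> R) (b : T -> bool) :
  measurable_fun [set: T] b -> L1 P f -> L1 P (fun t => f t * (b t)%:R).
Proof.
move=> mb If; have /measurable_EFinP mf := measurable_int P If.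
apply: le_integrable If => //.
  apply/measurable_EFinP.
  rewrite (_ : (fun t => _) = fun t => if b t then f t else 0); last first.
    by apply/funext => t; case: (b t); rewrite ?mulr1 ?mulr0.
  exact: measurable_fun_ifT.
by move=> t _ /=; case: (b t); rewrite ?mulr1 ?mulr0 ?normr0 ?lee_fin.
Qed.

Lemma L1_bool {dT : measure_display} {T : measurableType dT} {R : realType}
    (P : probability T R) (b : T -> bool) :
  measurable_fun [set: T] b -> L1 P (fun t => (b t)%:R).
Proof.
move=> mb; have := L1M_bool mb (L1_cst P 1).
by under [X in L1 P X]eq_fun do rewrite mul1r.
Qed.

Ltac L1_tac := repeat first
  [ solve [auto] | apply: L1_cst | apply: L1B | apply: L1D | apply: L1Z
  | apply: L1M_bool | apply: L1_bool ].

Lemma meanE {dT : measure_display} {T : measurableType dT} {R : realType}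
    (P : probability T R) (f : T -> R) : mean P f = Rintegral P [set: T] f.
Proof. by rewrite /mean unlock. Qed.

Lemma meanD {dT : measure_display} {T : measurableType dT} {R : realType}
    (P : probability T R) (f g : T -> R) : L1 P f -> L1 P g ->
  mean P (fun t => f t + g t) = mean P f + mean P g.
Proof. by move=> If Ig; rewrite !meanE RintegralD. Qed.

Lemma meanB {dT : measure_display} {T : measurableType dT} {R : realType}
    (P : probability T R) (f g : T -> R) : L1 P f -> L1 P g ->
  mean P (fun t => f t - g t) = mean P f - mean P g.
Proof. by move=> If Ig; rewrite !meanE RintegralB. Qed.

Lemma meanZ {dT : measure_display} {T : measurableType dT} {R : realType}
    (P : probability T R) (k : R) (f : T -> R) : L1 P f ->
  mean P (fun t => k * f t) = k * mean P f.
Proof. by move=> If; rewrite !meanE RintegralZl. Qed.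

Lemma mean_cst {dT : measure_display} {T : measurableType dT} {R : realType}
    (P : probability T R) (k : R) : mean P (fun=> k) = k.
Proof. by rewrite meanE Rintegral_cst//= probability_setT mulr1. Qed.

Lemma mean_bool {dT : measure_display} {T : measurableType dT} {R : realType}
    (P : probability T R) (b : T -> bool) : measurable_fun [set: T] b ->
  mean P (fun t => (b t)%:R) = prob P [set t | b t = true].
Proof.
move=> mb; have mA : measurable [set t | b t = true].
  by rewrite -[X in measurable X]setTI; exact: (mb measurableT [set true]).
rewrite meanE /prob -[X in P X]setIT -integral_indic// /Rintegral.
congr fine; apply: eq_integral => t _; rewrite indicE; congr (_%:R%:E).
by case bt: (b t); [rewrite mem_set|rewrite memNset//= bt].
Qed.

Lemma mean_indepM {dT : measure_display} {T : measurableType dT}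
    {R : realType} (P : probability T R) (X : T -> R) (W : T -> bool) :
  measurable_fun [set: T] W -> mean P (fun t => (W t)%:R) != 0 ->
  mean_indep P X W ->
  mean P (fun t => X t * (W t)%:R) = mean P X * mean P (fun t => (W t)%:R).
Proof.
move=> mW; rewrite mean_bool// => PW /(_ _ PW) <-; rewrite /cond_mean divfK//.
by under [in RHS]eq_fun do rewrite eqb_id.
Qed.

Lemma L1_residual {dT : measure_display} {T : measurableType dT}
    {R : realType} (P : probability T R) (D X : T -> bool) (V : T -> R)
    (c : coefs R) :
  measurable_fun [set: T] D -> measurable_fun [set: T] X -> L1 P V ->
  L1 P (residual D X V c).
Proof.
move=> mD mX IV.
rewrite (_ : residual D X V c = fun t =>
   V t - (a0 c * (D t)%:R + a1 c * ((D t)%:R * (X t)%:R)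
          + (b0 c * (1 - (D t)%:R)
             + b1 c * ((X t)%:R - (D t)%:R * (X t)%:R)))); first by L1_tac.
by apply/funext => t; rewrite /residual; ring.
Qed.

(* If D vanished almost surely, any shift of a_0 would preserve the moment
   conditions; likewise for b_0 and 1 - D. *)
Lemma IV_limit_overlap {dT : measure_display} {T : measurableType dT}
    {R : realType} (P : probability T R) (D Z X : T -> bool) (V : T -> R)
    (c : coefs R) :
  measurable_fun [set: T] D -> measurable_fun [set: T] Z ->
  measurable_fun [set: T] X -> L1 P V ->
  mean P (fun t => (D t)%:R * (Z t)%:R) =
    mean P (fun t => (D t)%:R) * mean P (fun t => (Z t)%:R) ->
  IV_limit P D Z X V c ->
  mean P (fun t => (D t)%:R) != 0 /\ 1 - mean P (fun t => (D t)%:R) != 0.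
Proof.
move=> mD mZ mX IV EDZ [[m1 m2 m3 m4] uniq].
set u := residual D X V c in m1 m2 m3 m4.
have Iu : L1 P u by exact: L1_residual.
have resE e f :
    residual D X V (Coefs (a0 c + e) (a1 c) (b0 c + f) (b1 c)) =
    fun t => u t - (e * (D t)%:R + f * (1 - (D t)%:R)).
  by apply/funext => t; rewrite /u /residual /=; ring.
clearbody u.
have EDu : mean P (fun t => u t * (D t)%:R) = 0.
  by rewrite -[RHS]m1; under eq_fun do rewrite mulrC.
have EDZu : mean P (fun t => u t * (D t)%:R * (Z t)%:R) = 0.
  rewrite -[RHS]m2; congr mean; apply/funext => t; ring.
have Eu : mean P u = 0.
  move: m3; under eq_fun do rewrite mulrBl mul1r mulrC.
  by rewrite meanB; [rewrite EDu subr0|L1_tac..].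
have EZu : mean P (fun t => u t * (Z t)%:R) = 0.
  move: m4; rewrite (_ : (fun t => _) = fun t =>
    u t * (Z t)%:R - u t * (D t)%:R * (Z t)%:R); last first.
    by apply/funext => t; ring.
  by rewrite meanB; [rewrite EDZu subr0|L1_tac..].
have DD (t : T) : (D t)%:R * (D t)%:R = (D t)%:R :> R.
  by case: (D t); rewrite ?mulr1 ?mulr0.
set p := mean P (fun t => (D t)%:R) in EDZ *.
have shift (e f : R) : e * p = 0 -> f * (1 - p) = 0 -> (e = 0) * (f = 0).
  move=> ep fp; have : Coefs (a0 c + e) (a1 c) (b0 c + f) (b1 c) = c.
    apply: uniq; rewrite /moment_conditions.
    rewrite resE; split.
    - rewrite (_ : (fun t => _) = fun t => u t * (D t)%:R - e * (D t)%:R).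
        rewrite meanB; [|L1_tac..].
        by rewrite meanZ; [rewrite EDu ep subr0|L1_tac].
      by apply/funext => t; ring: (DD t).
    - rewrite (_ : (fun t => _) = fun t =>
          u t * (D t)%:R * (Z t)%:R - e * ((D t)%:R * (Z t)%:R)).
        rewrite meanB; [|L1_tac..].
        by rewrite meanZ; [rewrite EDZu EDZ mulrA ep mul0r subr0|L1_tac].
      by apply/funext => t; ring: (DD t).
    - rewrite (_ : (fun t => _) = fun t =>
          u t - u t * (D t)%:R - f * (1 - (D t)%:R)).
        rewrite meanB; [|L1_tac..]; rewrite meanB; [|L1_tac..].
        rewrite meanZ; [|L1_tac]; rewrite meanB; [|L1_tac..].
        by rewrite mean_cst fp EDu Eu !subr0.
      by apply/funext => t; ring: (DD t).
    - rewrite (_ : (fun t => _) = fun t =>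
          u t * (Z t)%:R - u t * (D t)%:R * (Z t)%:R
          - f * ((Z t)%:R - (D t)%:R * (Z t)%:R)).
        rewrite meanB; [|L1_tac..]; rewrite meanB; [|L1_tac..].
        rewrite meanZ; [|L1_tac]; rewrite meanB; [|L1_tac..].
        by rewrite EDZu EZu EDZ -[X in X - p * _]mul1r -mulrBl mulrA fp mul0r !subr0.
      by apply/funext => t; ring: (DD t).
  move=> cc; split; [have := congr1 (@a0 R) cc|have := congr1 (@b0 R) cc];
    by rewrite /= -[RHS]addr0 => /addrI.
split; apply/eqP => p0.
  have [/eqP] : ((1 : R) = 0) * ((0 : R) = 0).
    by apply: shift; rewrite ?p0 ?mulr0 ?mul0r.
  by rewrite oner_eq0.
have [_ /eqP] : ((0 : R) = 0) * ((1 : R) = 0).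
  by apply: shift; rewrite ?p0 ?mulr0 ?mul0r.
by rewrite oner_eq0.
Qed.

Lemma first_stage_mean {dT : measure_display} {T : measurableType dT}
    {R : realType} (P : probability T R) (D Z : T -> bool) (V V1 V0 : T -> R)
    (c : coefs R) :
  measurable_fun [set: T] D -> measurable_fun [set: T] Z ->
  L1 P V1 -> L1 P V0 -> (forall t, V t = if D t then V1 t else V0 t) ->
  mean_indep P V1 D -> mean_indep P V0 D ->
  mean P (fun t => (D t)%:R * (Z t)%:R) =
    mean P (fun t => (D t)%:R) * mean P (fun t => (Z t)%:R) ->
  IV_limit P D Z Z V c ->
  a0 c + a1 c * mean P (fun t => (Z t)%:R) = mean P V1 /\
  b0 c + b1 c * mean P (fun t => (Z t)%:R) = mean P V0.
Proof.
move=> mD mZ I1 I0 VE ind1 ind0 EDZ lim.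
have IV : L1 P V.
  rewrite (_ : V = fun t => V1 t * (D t)%:R + (V0 t - V0 t * (D t)%:R)).
    by L1_tac.
  by apply/funext => t; rewrite VE; case: (D t) => /=; ring.
have [p0 p1] := IV_limit_overlap mD mZ mZ IV EDZ lim.
have [[m1 _ m3 _] _] := lim.
have E1 := mean_indepM mD p0 ind1; have E0 := mean_indepM mD p0 ind0.
set p := mean P (fun t => (D t)%:R) in EDZ p0 p1 E1 E0 *.
set q := mean P (fun t => (Z t)%:R) in EDZ *.
split; apply/eqP; rewrite eq_sym -subr_eq0.
  rewrite -(mulrI_eq0 _ (mulfI p0)) -[X in _ == X]m1; apply/eqP.
  rewrite (_ : (fun t => _) = fun t => V1 t * (D t)%:R
      - (a0 c * (D t)%:R + a1 c * ((D t)%:R * (Z t)%:R))).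
    rewrite meanB; [|L1_tac..]; rewrite meanD; [|L1_tac..].
    by rewrite !meanZ; [rewrite E1 EDZ -/p; ring|L1_tac..].
  by apply/funext => t; rewrite /residual VE; case: (D t) => /=; ring.
rewrite -(mulrI_eq0 _ (mulfI p1)) -[X in _ == X]m3; apply/eqP.
rewrite (_ : (fun t => _) = fun t => V0 t - V0 t * (D t)%:R
    - (b0 c * (1 - (D t)%:R) + b1 c * ((Z t)%:R - (D t)%:R * (Z t)%:R))).
  rewrite meanB; [|L1_tac..]; rewrite meanB; [|L1_tac..].
  rewrite meanD; [|L1_tac..]; rewrite !meanZ; [|L1_tac..].
  rewrite !meanB; [|L1_tac..].
  by rewrite mean_cst E0 EDZ -/p -/q; ring.
by apply/funext => t; rewrite /residual VE; case: (D t) => /=; ring.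
Qed.

Theorem proposition1 (dT : measure_display) (T : measurableType dT)
  (R : realType) (P : probability T R)
  (D Z M : T -> bool) (Y : T -> R)
  (Mp : bool -> bool -> T -> bool)
  (Yp : bool -> bool -> T -> R)
  (Yp3 : bool -> bool -> bool -> T -> R)
  (cY cM : coefs R)
  (mD : measurable_fun [set: T] D)
  (mZ : measurable_fun [set: T] Z)
  (mMp : forall d z : bool, measurable_fun [set: T] (Mp d z))
  (iYp : forall d m : bool, P.-integrable [set: T] (EFin \o Yp d m))
  (obsM : forall t : T, M t = Mp (D t) (Z t) t)
  (obsY : forall t : T, Y t = Yp (D t) (Mp (D t) (Z t) t) t)
  (exogeneity : treatment_exogeneity P D Z Mp Yp)
  (randomization : instrument_randomization P D Z Mp Yp)
  (exclusion : forall (d m z : bool) (t : T), Yp3 d m z t = Yp d m t)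
  (relevance : instrument_relevance P M Z)
  (limY : IV_limit P D Z M Y cY)
  (limM : IV_limit P D Z Z (fun t => (M t)%:R) cM)
  (constant_effects : forall d m d' m' : bool,
     exists k : R, forall t : T, Yp d' m' t - Yp d m t = k) :
  let EZ := mean P (fun t => (Z t)%:R) in
  forall d : bool,
    NIE_IV cY cM EZ d = NIE P Z Mp Yp d /\
    NDE_IV cY cM EZ d = NDE P Z Mp Yp d.
Proof.
move=> EZ.
pose MZ d t := Mp d (Z t) t.
pose Y0 := Yp false false.
have I0 : L1 P Y0 by exact: iYp.
pose mu := mean P Y0.
pose k d m := mean P (Yp d m) - mu.
have YpE d m t : Yp d m t = Y0 t + k d m.
  have [r Yr] := constant_effects false false d m.
  have {}Yr s : Yp d m s = Y0 s + r by rewrite -(Yr s) addrC subrK.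
  rewrite Yr /k; congr (_ + _); rewrite (_ : Yp d m = fun s => Y0 s + r).
    by rewrite meanD; [rewrite mean_cst -/mu addrAC subrr add0r|L1_tac..].
  exact/funext.
have k00 : k false false = 0 by rewrite /k subrr.
have mMZ d : measurable_fun [set: T] (MZ d).
  rewrite (_ : MZ d = fun t => if Z t then Mp d true t else Mp d false t).
    exact: measurable_fun_ifT.
  by apply/funext => t; rewrite /MZ; case: (Z t).
have EZ0 : EZ != 0 by rewrite /EZ mean_bool// gt_eqF// relevance.1.
have rand := randomization false false false false.
have iYZ : mean_indep P Y0 Z.
  move: (rand [:: true]); rewrite /mask /=.
  by under [X in mean_indep P X]eq_fun do rewrite big_seq1.
have iDZ : mean_indep P (fun t => (D t)%:R) Z.
  move: (rand [:: false; false; true]); rewrite /mask /=.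
  by under [X in mean_indep P X]eq_fun do rewrite big_seq1.
have iYDZ : mean_indep P (fun t => Y0 t * (D t)%:R) Z.
  move: (rand [:: true; false; true]); rewrite /mask /=.
  by under [X in mean_indep P X]eq_fun do rewrite big_cons big_seq1.
have iYD : mean_indep P Y0 D.
  move: (exogeneity false false false [:: true]); rewrite /mask /=.
  by under [X in mean_indep P X]eq_fun do rewrite big_seq1.
have iMD d : mean_indep P (fun t => (MZ d t)%:R) D.
  move: (exogeneity false d false [:: false; true]); rewrite /mask /=.
  by under [X in mean_indep P X]eq_fun do rewrite big_seq1.
have EDZ := mean_indepM mZ EZ0 iDZ.
have ME t : (M t)%:R = if D t then (MZ true t)%:R else (MZ false t)%:R :> R.
  by rewrite obsM /MZ; case: (D t).
have [Epi Etau] := first_stage_mean mD mZ (L1_bool P (mMZ true))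
  (L1_bool P (mMZ false)) ME (iMD true) (iMD false) EDZ limM.
have mM : measurable_fun [set: T] M.
  rewrite (_ : M = fun t => if D t then MZ true t else MZ false t).
    exact: measurable_fun_ifT.
  by apply/funext => t; rewrite obsM /MZ; case: (D t).
have [p0 _] := IV_limit_overlap mD mZ mZ (L1_bool P mM) EDZ limM.
have EYZ := mean_indepM mZ EZ0 iYZ.
have EYD := mean_indepM mD p0 iYD.
have EYDZ := mean_indepM mZ EZ0 iYDZ.
rewrite -/EZ in EDZ Epi Etau EYZ EYDZ.
have cYE : cY = Coefs (mu + k true false) (k true true - k true false)
                      mu (k false true).
  symmetry; apply: limY.2; rewrite /moment_conditions.
  set c := Coefs _ _ _ _.
  have -> : residual D M Y c = fun t => Y0 t - mu.
    apply/funext => t; rewrite /residual obsY YpE obsM /c /Y0 /=.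
    by case: (D t) => /=; case: (Mp _ _ _) => /=; rewrite ?k00; ring.
  split.
  - rewrite (_ : (fun t => _) = fun t => Y0 t * (D t)%:R - mu * (D t)%:R).
      rewrite meanB; [|L1_tac..]; rewrite meanZ; [|L1_tac].
      by rewrite EYD subrr.
    by apply/funext => t; ring.
  - rewrite (_ : (fun t => _) = fun t =>
        Y0 t * (D t)%:R * (Z t)%:R - mu * ((D t)%:R * (Z t)%:R)).
      rewrite meanB; [|L1_tac..]; rewrite meanZ; [|L1_tac].
      by rewrite EYDZ EYD EDZ -/mu; ring.
    by apply/funext => t; ring.
  - rewrite (_ : (fun t => _) = fun t =>
        Y0 t - mu - (Y0 t * (D t)%:R - mu * (D t)%:R)).
      rewrite meanB; [|L1_tac..]; rewrite !meanB; [|L1_tac..].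
      rewrite meanZ; [|L1_tac].
      by rewrite mean_cst EYD -/mu; ring.
    by apply/funext => t; ring.
  - rewrite (_ : (fun t => _) = fun t =>
        Y0 t * (Z t)%:R - mu * (Z t)%:R
        - (Y0 t * (D t)%:R * (Z t)%:R - mu * ((D t)%:R * (Z t)%:R))).
      rewrite meanB; [|L1_tac..]; rewrite !meanB; [|L1_tac..].
      rewrite !meanZ; [|L1_tac..].
      by rewrite EYZ EYDZ EYD EDZ -/mu -/EZ; ring.
    by apply/funext => t; ring.
have IMZ d : L1 P (fun t => (MZ d t)%:R) by L1_tac.
move=> d; split.
  have -> : NIE P Z Mp Yp d = (k d true - k d false) *
      (mean P (fun t => (MZ true t)%:R) - mean P (fun t => (MZ false t)%:R)).
    rewrite -meanB// -meanZ; last by L1_tac.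
    congr mean; apply/funext => t; rewrite !(YpE d) /MZ.
    by case: (Mp true (Z t) t); case: (Mp false (Z t) t) => /=; ring.
  by rewrite -Epi -Etau cYE /NIE_IV; case: d; rewrite /= ?k00; ring.
have -> : NDE P Z Mp Yp d = k true false - k false false +
    (k true true - k false true - (k true false - k false false)) *
    mean P (fun t => (MZ d t)%:R).
  rewrite -meanZ// -[X in X + _](mean_cst P) -meanD; [|L1_tac..].
  congr mean; apply/funext => t; rewrite (YpE true) (YpE false) /MZ.
  by case: (Mp _ _ _) => /=; ring.
rewrite cYE /NDE_IV; case: d; rewrite /= ?Epi ?Etau ?k00; last by ring.
by ring.
Qed.
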